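(* Let $I\subseteq\mathbb{R}$ be a nonempty open interval. Suppose that the functions $\varphi,\psi_1:I\to\mathbb{R}$ satisfy $$\varphi\Big(\frac{x+y}{2}\Big)\big(\psi_1(x)+\psi_1(y)\big)=\varphi(x)\psi_1(x)+\varphi(y)\psi_1(y)\qquad\text{for all }x,y\in I.$$ Suppose that there exist differentiable functions $F,g_1,g_2:I\to\mathbb{R}$ such that $0<g_1'(x)\cdot g_2'(x)$ for all $x\in I$, and $\varphi=\frac12F'$ and $\psi_1=\frac1{g_1'}-\frac1{g_2'}$ on $I$. Assume also that there is no nonempty open interval $L\subseteq I$ such that $\varphi$ is constant on $L$. Then either $\psi_1$ is identically zero on $I$, or $0\notin\psi_1(I)$ and $\varphi,\psi_1$ are continuous functions. *)

(* Defs.v *)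
From mathcomp Require Import all_boot all_order all_algebra.
From mathcomp Require Import all_classical all_reals all_analysis.
Import Order.TTheory GRing.Theory Num.Theory numFieldNormedType.Exports.

Set Implicit Arguments.
Unset Strict Implicit.
Unset Printing Implicit Defensive.

Local Open Scope ring_scope.
Local Open Scope classical_set_scope.

(* Possibly unbounded. *)
Definition nonempty_open_interval (R : realType) (I : set R) : Prop :=
  [/\ I !=set0, open I & is_interval I].

(* A function on an open set I is represented by a function on R of which only
   the values on I matter: derivability and the derivative at a point of I
   depend only on the germ there. *)
Definition differentiable_on (R : realType) (I : set R) (f : R -> R) : Prop :=
  forall x, I x -> derivable f x 1.

(* Main.v *)
Require Import Defs.
From mathcomp Require Import all_boot all_order all_algebra.
From mathcomp Require Import all_classical all_reals all_analysis.
From mathcomp Require Import ring lra.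
Import Order.TTheory GRing.Theory Num.Theory numFieldNormedType.Exports.

Set Implicit Arguments.
Unset Strict Implicit.
Unset Printing Implicit Defensive.

Local Open Scope ring_scope.
Local Open Scope classical_set_scope.

(** Write psi for psi1, f = phi - c for a constant c, and h = f * psi.
Subtracting a constant from phi preserves the equation, so
f ((x + y) / 2) * (psi x + psi y) = h x + h y.  At a point q with f q = 0 this
says that h is odd under the reflection x |-> 2 * q - x.

What turns such reflections into rigidity is Baire category.  The functions
phi and psi are pointwise limits of continuous functions: phi is a limit of
difference quotients, and 1 / g' is the limit of the inverses of difference
quotients of g, which do not vanish because g is injective when g' has no zero.
By Baire's theorem such a limit oscillates arbitrarily little on some
subinterval of any interval ([baire_one_osc]).  Hence, if its zeros are dense
and it is odd under reflection in each point of a dense set, it vanishes: a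
nonzero value would be reproduced, up to sign, densely often next to zeros
([baire_one_reflect_eq0]).

Two further facts come from Darboux's theorem.  Since psi * g1' * g2' is the
derivative of g2 - g1, the function psi has constant sign on any interval where
it has no zero; and phi, half a derivative, has the intermediate value property.

Suppose that psi has no zero between a and b and that phi a = phi b = c.  The
sums psi x + psi y do not vanish, so the level set of c is closed under
midpoints, hence dense between a and b; reflecting h in its points gives h = 0,
so phi = c on the whole interval, against the nonconstancy of phi.  Thus phi is
injective wherever psi does not vanish ([nonvanishing_inj]).

Suppose now that psi has both a zero z and a point u with psi u <> 0.  For all
such pairs phi ((z + u) / 2) = phi u.  If u had a positive distance to the
zeros, then choosing z almost nearest to u would put (z + u) / 2 in the
zero-free neighbourhood of u, contradicting injectivity there; so the zeros are
dense ([zeros_dense]).  Consequently, for two such points u and v, both values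
phi u and phi v are taken densely around (u + v) / 2, and small oscillation
forces them to agree: phi has a single value c off the zeros ([phi_eq_off_zeros]).  Then h = 0 everywhere, so
psi itself is odd under reflection in each point of the dense set phi <> c, and
psi vanishes: a contradiction ([zero_or_nonvanishing]).

If psi has no zero, phi is injective with the intermediate value property,
hence continuous, and solving the equation for psi x in terms of phi gives the
continuity of psi ([weight_continuous]). *)

(** * Pointwise limits of continuous functions *)

Definition baire_one (R : realType) (a b : R) (h : R -> R) : Prop :=
  exists hn : nat -> R -> R, forall x, a < x < b ->
    (forall n, {for x, continuous (hn n)}) /\ hn n x @[n --> \oo] --> h x.

Lemma baire_one_cst (R : realType) (a b c : R) : baire_one a b (fun=> c).
Proof. by exists (fun=> fun=> c) => x _; split=> [n|]; apply: cvg_cst. Qed.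

Lemma baire_oneB (R : realType) (a b : R) (f g : R -> R) :
  baire_one a b f -> baire_one a b g -> baire_one a b (fun x => f x - g x).
Proof.
move=> [fn hf] [gn hg]; exists (fun n x => fn n x - gn n x) => x xab.
have [cf lf] := hf x xab; have [cg lg] := hg x xab.
by split=> [n|]; apply: cvgB => //; [exact: cf | exact: cg].
Qed.

Lemma baire_oneM (R : realType) (a b : R) (f g : R -> R) :
  baire_one a b f -> baire_one a b g -> baire_one a b (fun x => f x * g x).
Proof.
move=> [fn hf] [gn hg]; exists (fun n x => fn n x * gn n x) => x xab.
have [cf lf] := hf x xab; have [cg lg] := hg x xab.
by split=> [n|]; apply: cvgM => //; [exact: cf | exact: cg].
Qed.

Lemma eq_baire_one (R : realType) (a b : R) (f g : R -> R) :
  (forall x, a < x < b -> f x = g x) -> baire_one a b f -> baire_one a b g.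
Proof.
move=> fg [fn hf]; exists fn => x xab.
by rewrite -fg//; exact: hf.
Qed.

(** A limit of continuous functions [hn] is uniformly close to a single [hn N] on
some subinterval: otherwise, for every N, the points where two functions of
index at least N differ by more than eps / 4 form a dense open set, and at a
point common to all these sets, which exists by Baire's theorem, [hn] is not a
Cauchy sequence. *)
Lemma baire_one_osc (R : realType) (a b eps : R) (h : R -> R) :
  a < b -> 0 < eps -> baire_one a b h ->
  exists c d, [/\ a <= c, c < d, d <= b &
    forall x y, c < x < d -> c < y < d -> `|h x - h y| < eps].
Proof.
move=> ab eps0 [hn hnP].
have e0 : 0 < eps / 4 by lra.
set e := eps / 4 in e0.
(* With the two outer rays included, density of O N in the whole line, which is
   what Baire's theorem is about, is a condition on what happens between a and b. *)
pose O N : set R := [set x | x < a] `|` [set x | b < x] `|`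
  [set x | a < x < b /\ exists n m, [/\ (N <= n)%N, (N <= m)%N &
     e < `|hn n x - hn m x| ]].
have openO N : open (O N).
  apply: openU; first by apply: openU; [exact: open_lt | exact: open_gt].
  rewrite openE => x /= [xab [n [m [Nn Nm enm]]]]; rewrite /interior /=.
  have cnt : {for x, continuous (fun y => `|hn n y - hn m y|)}.
    have [cn _] := hnP x xab.
    by apply: cvg_norm; apply: cvgB; exact: cn.
  near=> y; split; last first.
    by exists n, m; split=> //; near: y; apply: (cvgr_gt _ cnt).
  near: y; have := @near_in_itvoo R a b x; rewrite in_itv/= xab => /(_ isT).
  by apply: filterS => y; rewrite in_itv.
have [N NdO] : exists N, ~ dense (O N).
  apply/existsNP => dO.
  have /Baire : forall N, open (O N) /\ dense (O N) by [].
  move=> /(_ `]a, b[%classic) [].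
  - by exists ((a + b) / 2); rewrite /= in_itv/=; lra.
  - exact: itv_open.
  move=> x /= [xab xO].
  have {}xab : a < x < b by move: xab; rewrite in_itv.
  have [_ /cvgrPdist_lt/(_ (e / 2))] := hnP x xab.
  move=> /(_ ltac:(lra)) [N _ Nx].
  have [[xa|bx]|[_ [n [m [/Nx /= nx /Nx /= mx]]]]] := xO N I.
  - by move: xa => /=; lra.
  - by move: bx => /=; lra.
  - by move: nx mx; rewrite !ltr_norml ltr_normr; lra.
have [V [[x [oV Vx]] /seteqP[V0 _]]] := denseNE NdO.
have Vab y : V y -> a <= y <= b.
  move=> Vy; apply/andP; split; rewrite leNgt; apply/negP => yN;
    case: (V0 y); split=> //; left; [by left|by right].
have Vsm y : V y -> forall n m, (N <= n)%N -> (N <= m)%N ->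
    a < y < b -> `|hn n y - hn m y| <= e.
  move=> Vy n m Nn Nm yab; rewrite leNgt; apply/negP => en.
  by case: (V0 y); split=> //; right; split=> //; exists n, m.
have [r r0 rV] : exists2 r, 0 < r & forall y, `|x - y| < r -> V y.
  have /nbhs_ballP[r r0 rV] : nbhs x V by exact: open_nbhs_nbhs.
  by exists r.
have rab y : `|x - y| < r / 2 -> V y /\ a < y < b.
  move=> xy; split; first by apply: rV; lra.
  have /Vab : V (x - r / 2) by apply: rV; rewrite ltr_norml; lra.
  have /Vab : V (x + r / 2) by apply: rV; rewrite ltr_norml; lra.
  by move: xy; rewrite ltr_norml; lra.
have hle y : `|x - y| < r / 2 -> `|h y - hn N y| <= e.
  move=> /rab [Vy yab].
  have [_ hy] := hnP y yab.
  have lim : `|hn n y - hn N y| @[n --> \oo] --> `|h y - hn N y|.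
    by apply: cvg_norm; apply: cvgB => //; exact: cvg_cst.
  apply: (cvgr_to_le lim).
  by exists N => // n /= Nn; exact: Vsm.
have xab : a < x < b by have [|] := rab x; rewrite ?subrr ?normr0//; lra.
have [cN _] := hnP x xab.
have /cvgrPdist_lt/(_ e e0)/nbhs_ballP[s s0 xs] := cN N.
have hs y : `|x - y| < s -> `|hn N x - hn N y| < e by exact: xs.
pose t := Num.min s (r / 2).
have t0 : 0 < t by rewrite lt_min; apply/andP; split=> //; lra.
have tle y : x - t < y < x + t -> `|x - y| < s /\ `|x - y| < r / 2.
  move=> yt; have : `|x - y| < t by rewrite ltr_norml; lra.
  by rewrite lt_min => /andP[].
exists (x - t / 2), (x + t / 2).
have xt z : x - t < z < x + t -> a < z < b by move=> /tle [_ /rab[]].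
split; [| lra | |].
- by have := xt (x - t / 2); lra.
- by have := xt (x + t / 2); lra.
move=> y z yt zt.
have /tle [/hs y1 /hle y2] : x - t < y < x + t by lra.
have /tle [/hs z1 /hle z2] : x - t < z < x + t by lra.
move: y1 y2 z1 z2; rewrite /e !ltr_norml !ler_norml; lra.
Unshelve. all: by end_near.
Qed.

(** * Derivatives *)

Lemma divSn_itv (R : realType) (d : R) (n : nat) :
  0 < d -> 0 < d / n.+1%:R <= d.
Proof.
move=> d0; rewrite divr_gt0//= ler_pdivrMr//.
by rewrite ler_peMr ?ler1n// ltW.
Qed.

Lemma diffquot_cvg (R : realType) (f : R -> R) (x d : R) :
  derivable f x 1 -> d != 0 ->
  (f (x + d / n.+1%:R) - f x) / (d / n.+1%:R) @[n --> \oo] --> derive1 f x.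
Proof.
move=> df d0; apply/cvgrPdist_lt => e e0.
have : h^-1 *: (f (h + x) - f x) @[h --> 0^'] --> derive1 f x.
  rewrite derive1E; move: df; rewrite /derivable /derive /=.
  suff -> : (fun h : R => h^-1 *: (f (h + x) - f x)) =
    (fun h : R => h^-1 *: (f (h *: 1 + x) - f x)) by [].
  by apply/funext => h; rewrite [h *: 1]mulr1.
move=> /cvgrPdist_lt/(_ e e0)[r /= r0 rf].
have rd : 0 < r / `|d| by rewrite divr_gt0// normr_gt0.
near=> n; have n0 : n.+1%:R != 0 :> R by rewrite pnatr_eq0.
have /= := rf (d / n.+1%:R); rewrite sub0r normrN [_^-1 *: _]mulrC (addrC _ x).
apply; last by rewrite mulf_neq0// invr_eq0.
rewrite normrM normfV normr_nat mulrC -ltr_pdivlMr ?normr_gt0//.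
by near: n; exact: (near_infty_natSinv_lt (PosNum rd)).
Unshelve. all: by end_near.
Qed.

Lemma derivable_continuous (R : realType) (f : R -> R) (x : R) :
  derivable f x 1 -> {for x, continuous f}.
Proof. by move=> /derivable1_diffP/differentiable_continuous. Qed.

Lemma diffquot_continuous (R : realType) (f : R -> R) (x t : R) :
  derivable f x 1 -> derivable f (x + t) 1 ->
  {for x, continuous (fun y => (f (y + t) - f y) / t)}.
Proof.
move=> /derivable_continuous cx /derivable_continuous cxt.
apply: cvgM; last exact: cvg_cst.
apply: cvgB => //; apply: continuous_comp => //=.
by apply: cvgD; [exact: cvg_id | exact: cvg_cst].
Qed.

(** The margin [d] leaves room for the forward difference quotients of step
d / n.+1 at every point below [b]. *)
Lemma baire_one_derive1 (R : realType) (f : R -> R) (a b d : R) :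
  0 < d -> (forall x, a < x < b + d -> derivable f x 1) ->
  baire_one a b (derive1 f).
Proof.
move=> d0 df.
exists (fun n x => (f (x + d / n.+1%:R) - f x) / (d / n.+1%:R)) => x xab.
have dx : derivable f x 1 by apply: df; lra.
split=> [n|]; last by apply: diffquot_cvg => //; rewrite gt_eqF.
apply: diffquot_continuous => //; apply: df.
by move: (divSn_itv n d0); set t := d / _; lra.
Qed.

Lemma derive1_neq0_inj (R : realType) (f : R -> R) (a b : R) :
  a < b -> (forall x, a <= x <= b -> derivable f x 1) ->
  (forall x, a <= x <= b -> derive1 f x != 0) -> f a != f b.
Proof.
move=> ab df f0; apply/eqP => fab.
have [||c /[!in_itv]/= cab dc] := Rolle ab _ _ fab.
- by move=> x /[!in_itv]/= xab; apply: df; lra.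
- by apply: derivable_within_continuous => x /[!in_itv]/=; exact: df.
have /eqP := f0 c ltac:(lra); apply.
by rewrite derive1E; exact: derive_val.
Qed.

(** The inverse of a limit of continuous functions need not be one, since the
approximants may vanish; here they are difference quotients of an injective
function. *)
Lemma baire_one_inv_derive1 (R : realType) (f : R -> R) (a b d : R) :
  0 < d -> (forall x, a < x < b + d -> derivable f x 1) ->
  (forall x, a < x < b + d -> derive1 f x != 0) ->
  baire_one a b (fun x => (derive1 f x)^-1).
Proof.
move=> d0 df f0.
exists (fun n x => ((f (x + d / n.+1%:R) - f x) / (d / n.+1%:R))^-1) => x xab.
have dx : derivable f x 1 by apply: df; lra.
split=> [n|]; last first.
  apply: cvgV; first by apply: f0; lra.
  by apply: diffquot_cvg => //; rewrite gt_eqF.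
have := divSn_itv n d0; set t := d / n.+1%:R => tb.
apply: cvgV; last by apply: diffquot_continuous => //; apply: df; lra.
have t0 : t != 0 by rewrite gt_eqF//; lra.
rewrite mulf_neq0 ?invr_eq0//.
rewrite subr_eq0 eq_sym; apply: derive1_neq0_inj; first by lra.
- by move=> y yx; apply: df; lra.
- by move=> y yx; apply: f0; lra.
Qed.

(** Darboux's theorem.  By Rolle's theorem [f] is injective, hence strictly
monotone, and all its difference quotients on the interval have the same sign;
those at the endpoints are taken inwards. *)
Lemma derive1_neq0_sign (R : realType) (f : R -> R) (a b : R) :
  a < b -> (forall x, a <= x <= b -> derivable f x 1) ->
  (forall x, a <= x <= b -> derive1 f x != 0) ->
  0 < derive1 f a * derive1 f b.
Proof.
move=> ab df f0.
have finj : {in `[a, b]%R &, injective f}.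
  move=> x y /[!in_itv]/= xab yab fxy; apply/eqP; apply: contraT.
  rewrite neq_lt => /orP[xy|yx].
  - suff : f x != f y by rewrite fxy eqxx.
    by apply: derive1_neq0_inj => // z zxy; [apply: df|apply: f0]; lra.
  - suff : f y != f x by rewrite fxy eqxx.
    by apply: derive1_neq0_inj => // z zxy; [apply: df|apply: f0]; lra.
have fc : {within `[a, b], continuous f}.
  by apply: derivable_within_continuous => x /[!in_itv]/=; exact: df.
have lim_ge0 (g : R -> R) x d : derivable g x 1 -> d != 0 ->
    (forall n, 0 <= (g (x + d / n.+1%:R) - g x) / (d / n.+1%:R)) ->
    0 <= derive1 g x.
  move=> dg d0 g0; apply: (cvgr_to_ge (diffquot_cvg dg d0)).
  by exists 0%N => // n _; exact: g0.
have dn n : 0 < (b - a) / n.+1%:R <= b - a.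
  by apply: divSn_itv; rewrite subr_gt0.
have key (g : R -> R) : {in `[a, b]%R &, {homo g : x y / x < y}} ->
    (forall x, a <= x <= b -> derivable g x 1) ->
    0 <= derive1 g a /\ 0 <= derive1 g b.
  move=> gm dg; split.
  - apply: (@lim_ge0 _ _ (b - a)); [by apply: dg; lra|lra|move=> n].
    move: (dn n); set t := (b - a) / _ => tb.
    apply: divr_ge0; last by lra.
    by rewrite subr_ge0 ltW// gm ?in_itv//=; lra.
  - apply: (@lim_ge0 _ _ (a - b)); [by apply: dg; lra|lra|move=> n].
    rewrite -(opprB b a) mulNr; move: (dn n); set t := (b - a) / _ => tb.
    rewrite invrN mulrN -mulNr opprB.
    apply: divr_ge0; last by lra.
    by rewrite subr_ge0 ltW// gm ?in_itv//=; lra.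
have [fm|fm] := itv_continuous_inj_mono fc finj.
- have [fa fb] := key f fm df.
  by apply: mulr_gt0; rewrite lt_neqAle eq_sym f0//; lra.
- have [||] := key (fun x => - f x).
  + by move=> x y xab yab xy; rewrite ltrN2 fm.
  + by move=> x xab; apply: derivableN; exact: df.
  rewrite !derive1E !deriveN; [|apply: df; lra..].
  rewrite !oppr_ge0 -!derive1E => fa fb.
  by rewrite nmulr_rgt0 lt_neqAle f0//; lra.
Qed.

(** * Midpoints and reflections *)

Definition dense_in (R : realType) (a b : R) (A : set R) : Prop :=
  forall s t, a <= s -> s < t -> t <= b -> exists2 x, s < x < t & A x.

(** Bisection: the midpoint of two points of [A] enclosing the interval from s to t
lies either inside it, or on one side, in which case it replaces the enclosing
point on that side and halves their distance. *)
Lemma midpoint_closed_dense (R : realType) (a b : R) (A : set R) :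
  A a -> A b ->
  (forall x y, a <= x <= b -> a <= y <= b -> A x -> A y -> A ((x + y) / 2)) ->
  dense_in a b A.
Proof.
move=> Aa Ab mid s t as_ st tb.
have bis n : forall x y, a <= x <= s -> t <= y <= b -> A x -> A y ->
    y - x <= 2 ^+ n * (t - s) -> exists2 x, s < x < t & A x.
  elim: n => [x y xs ty Ax Ay|n IH x y xs ty Ax Ay].
    rewrite expr0 => xy; exists ((x + y) / 2); first by lra.
    by apply: mid => //; lra.
  rewrite exprS => xy.
  have Am : A ((x + y) / 2) by apply: mid => //; lra.
  have [ms|sm] := leP ((x + y) / 2) s; first by apply: (IH _ y) Am Ay _ => //; lra.
  have [tm|mt] := leP t ((x + y) / 2); first by apply: (IH x _) Ax Am _ => //; lra.
  by exists ((x + y) / 2) => //; rewrite sm.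
pose n := Num.bound ((b - a) / (t - s)).
apply: (bis n a b) Aa Ab _; [lra..|].
rewrite -ler_pdivrMr ?subr_gt0//.
have : (b - a) / (t - s) < n%:R.
  by apply: archi_boundP; rewrite divr_ge0//; lra.
move/ltW/le_trans; apply; rewrite -natrX ler_nat ltnW//; exact: ltn_expl.
Qed.

(** On a subinterval where [h] oscillates by less than |h p| there is a zero of
[h]; reflecting [p] in a suitable point of [Q] lands in this subinterval, where
|h p| is then a value of |h|. *)
Lemma baire_one_reflect_eq0 (R : realType) (a b : R) (h : R -> R) (Q : set R) :
  baire_one a b h -> dense_in a b Q -> dense_in a b [set x | h x = 0] ->
  (forall p q, a < p < b -> a < q < b -> a < 2 * q - p < b -> Q q ->
    h (2 * q - p) = - h p) ->
  forall p, a < p < b -> h p = 0.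
Proof.
move=> Bh dQ dh refl p pab; apply/eqP; apply: contraT => hp.
have ab : a < b by lra.
have e0 : 0 < `|h p| by rewrite normr_gt0.
have [c [d [ac cd db osc]]] := baire_one_osc ab e0 Bh.
have [z zcd /= hz] := dh c d ac cd db.
have [||| q qcd Qq] := dQ ((p + c) / 2) ((p + d) / 2); [lra..|].
have := osc (2 * q - p) z ltac:(lra) zcd.
by rewrite hz subr0 refl// ?normrN ?ltxx//; lra.
Qed.

(** * The zeros of the weight *)

(** All that the dichotomy for the zeros of [psi] uses: derivatives enter it only
through pointwise approximation and the sign of [psi]. *)
Record regular_solution (R : realType) (I : set R) (phi psi : R -> R) : Prop := {
  sol_open : open I;
  sol_itv : is_interval I;
  sol_eq : forall x y, I x -> I y ->
    phi ((x + y) / 2) * (psi x + psi y) = phi x * psi x + phi y * psi y;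
  sol_phi_baire : forall a b, I a -> I b -> baire_one a b phi;
  sol_psi_baire : forall a b, I a -> I b -> baire_one a b psi;
  sol_psi_sign : forall a b, I a -> I b -> a < b ->
    (forall x, a <= x <= b -> psi x != 0) -> 0 < psi a * psi b;
  sol_phi_nonconstant : forall a b c, I a -> I b -> a < b ->
    exists2 x, a < x < b & phi x != c }.

Lemma open_ball_in (R : realType) (I : set R) (x : R) :
  open I -> I x -> exists2 r, 0 < r & I (x - r) /\ I (x + r).
Proof.
move=> oI Ix; have /nbhs_ballP[r r0 rI] : nbhs x I by exact: open_nbhs_nbhs.
by exists (r / 2); [exact: divr_gt0|split; apply: rI => /=;
  move: r0 => /=; rewrite /ball/= ltr_norml; lra].
Qed.

Lemma zero_midpoint (R : realType) (I : set R) (phi psi : R -> R) (z y : R) :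
  regular_solution I phi psi -> I z -> I y -> psi z = 0 -> psi y != 0 ->
  phi ((z + y) / 2) = phi y.
Proof.
move=> sol Iz Iy z0 y0; have := sol_eq sol Iz Iy.
by rewrite z0 mulr0 !add0r => /(mulIf y0).
Qed.

(** If phi a = phi b, the level set of this value is closed under midpoints, hence
dense, and (phi - phi a) * psi is odd under reflection in its points; so it
vanishes and [phi] is constant between [a] and [b]. *)
Lemma nonvanishing_inj (R : realType) (I : set R) (phi psi : R -> R) (a b : R) :
  regular_solution I phi psi -> I a -> I b -> a < b ->
  (forall x, a <= x <= b -> psi x != 0) -> phi a != phi b.
Proof.
move=> sol Ia Ib ab psi0; apply/eqP => phiab.
have Iab x : a <= x <= b -> I x by exact: (sol_itv sol Ia Ib).
have sgn x y : a <= x <= b -> a <= y <= b -> psi x + psi y != 0.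
  move=> xab yab.
  have : 0 < psi x * psi y.
    have [xy|yx|->] := ltgtP x y.
    - apply: (sol_psi_sign sol) => //; [exact: Iab..|].
      by move=> z zxy; apply: psi0; lra.
    - rewrite mulrC; apply: (sol_psi_sign sol) => //; [exact: Iab..|].
      by move=> z zxy; apply: psi0; lra.
    - by rewrite -expr2 exprn_even_gt0//= psi0.
  by apply: contraTneq; nra.
have level : dense_in a b [set x | phi x = phi a].
  apply: midpoint_closed_dense => // x y xab yab /= xa ya.
  have := sol_eq sol (Iab _ xab) (Iab _ yab).
  by rewrite xa ya -mulrDr => /(mulIf (sgn _ _ xab yab)).
pose h x := (phi x - phi a) * psi x.
have h0 : forall p, a < p < b -> h p = 0.
  apply: (@baire_one_reflect_eq0 _ _ _ _ [set x | phi x = phi a]) => //.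
  - apply: baire_oneM; last exact: (sol_psi_baire sol).
    by apply: baire_oneB; [exact: (sol_phi_baire sol)|exact: baire_one_cst].
  - move=> s t as_ st tb; have [x xst xa] := level s t as_ st tb.
    by exists x => //=; rewrite /h xa subrr mul0r.
  move=> p q pab qab qpab /= qa.
  have := sol_eq sol (Iab p ltac:(lra)) (Iab (2 * q - p) ltac:(lra)).
  have -> : (p + (2 * q - p)) / 2 = q by field.
  by rewrite qa /h; lra.
have [x xab /eqP] := sol_phi_nonconstant sol (phi a) Ia Ib ab; apply.
have /eqP := h0 x xab; rewrite mulf_eq0 subr_eq0 => /orP[/eqP//|].
by rewrite (negPf (psi0 _ _))//; lra.
Qed.

(** Let [u] be a point with no zero of [psi] nearby, rho its distance to the zeros
and [z] a zero at distance less than 2 * rho.  Then (z + u) / 2 is at distance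
less than rho from [u], so [phi] is injective on the segment joining them; but
it takes the same value at both, by [zero_midpoint]. *)
Lemma zeros_dense (R : realType) (I : set R) (phi psi : R -> R) (z0 a b : R) :
  regular_solution I phi psi -> I z0 -> psi z0 = 0 -> I a -> I b ->
  dense_in a b [set x | psi x = 0].
Proof.
move=> sol Iz0 psiz0 Ia Ib s t as_ st tb; apply: contrapT => noz.
have Is : I s by apply: (sol_itv sol Ia Ib); lra.
have It : I t by apply: (sol_itv sol Ia Ib); lra.
have nz x : s < x < t -> psi x != 0.
  by move=> xst; apply/eqP => x0; apply: noz; exists x.
pose u := (s + t) / 2.
have Iu : I u by apply: (sol_itv sol Is It); rewrite /u; lra.
pose D := [set `|z - u| | z in [set z | I z /\ psi z = 0]].
have D0 : D !=set0 by exists `|z0 - u|, z0.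
have Dlb : lbound D ((t - s) / 2).
  move=> _ [z [Iz z0'] <-]; rewrite leNgt; apply/negP => zu.
  suff /eqP : psi z != 0 by apply.
  by apply: nz; move: zu; rewrite ltr_norml /u; lra.
have rho0 : 0 < inf D by have := lb_le_inf D0 Dlb; lra.
have Dinf x : I x -> `|x - u| < inf D -> psi x != 0.
  move=> Ix; apply: contraTneq => x0; rewrite -leNgt; apply: ge_inf.
    by exists ((t - s) / 2).
  by exists x.
have [|_ [z [Iz psiz] <-] zu] := @inf_adherent _ D (inf D) rho0.
  by split=> //; exists ((t - s) / 2).
have psiu : psi u != 0 by apply: Dinf => //; rewrite subrr normr0.
have mu := zero_midpoint sol Iz Iu psiz psiu.
have znu : z != u by apply: contra_neq psiu => <-.
have Im : I ((z + u) / 2).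
  have [zlu|ulz] := leP z u.
  - by apply: (sol_itv sol Iz Iu); lra.
  - by apply: (sol_itv sol Iu Iz); lra.
move: znu; rewrite neq_lt => /orP[zlu|ulz].
- have /eqP : phi ((z + u) / 2) != phi u.
    apply: (nonvanishing_inj sol) => //; first by lra.
    move=> x xmu; apply: Dinf; first by apply: (sol_itv sol Im Iu).
    by move: zu; rewrite !ltr_norml; lra.
  by apply.
- have /eqP : phi u != phi ((z + u) / 2).
    apply: (nonvanishing_inj sol) => //; first by lra.
    move=> x xmu; apply: Dinf; first by apply: (sol_itv sol Iu Im).
    by move: zu; rewrite !ltr_norml; lra.
  by apply.
Qed.

(** Around (u + v) / 2 lies an interval that meets both midpoint sets
{(z + u) / 2} and {(z + v) / 2}, z a zero of [psi], in a dense set: there [phi]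
takes the values phi u and phi v densely, so they agree by [baire_one_osc]. *)
Lemma phi_eq_off_zeros (R : realType) (I : set R) (phi psi : R -> R)
    (z0 u v : R) :
  regular_solution I phi psi -> I z0 -> psi z0 = 0 ->
  I u -> I v -> u < v -> psi u != 0 -> psi v != 0 -> phi u = phi v.
Proof.
move=> sol Iz0 psiz0 Iu Iv uv u0 v0; apply/eqP; apply: contraT => uv'.
have [r r0 [Iur _]] := open_ball_in (sol_open sol) Iu.
have [r' r'0 [_ Ivr]] := open_ball_in (sol_open sol) Iv.
pose d := Num.min r r'.
have d0 : 0 < d by rewrite lt_min r0.
have [dr dr'] : d <= r /\ d <= r' by rewrite !ge_min !lexx orbT.
have Iud x : u - r <= x <= v + r' -> I x by exact: (sol_itv sol Iur Ivr).
have e0 : 0 < `|phi u - phi v| by rewrite normr_gt0 subr_eq0.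
have [|c [e [ac ce eb osc]]] := baire_one_osc _ e0
  (sol_phi_baire sol (Iud ((u + v - d) / 2) ltac:(lra))
                     (Iud ((u + v + d) / 2) ltac:(lra))); first by lra.
have Zd := zeros_dense sol Iz0 psiz0 Iur Ivr.
(* x and y are zeros whose midpoints with u and v fall between c and e; the margin
   d, which makes them fall near v and near u, keeps them in I. *)
have [||| x xce psix] := Zd (2 * c - u) (2 * e - u); [lra..|].
have [||| y yce psiy] := Zd (2 * c - v) (2 * e - v); [lra..|].
have Ix : I x by apply: Iud; lra.
have Iy : I y by apply: Iud; lra.
have := osc ((x + u) / 2) ((y + v) / 2) ltac:(lra) ltac:(lra).
by rewrite (zero_midpoint sol Ix Iu psix u0) (zero_midpoint sol Iy Iv psiy v0) ltxx.
Qed.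

(** A zero of [psi] together with a point u where psi u <> 0 would make
(phi - phi u) * psi vanish identically.  The equation then reads psi x + psi y = 0 whenever [phi] of
the midpoint is not phi u, so that [psi] is odd under reflection in a dense set
of points and has to vanish. *)
Lemma zero_or_nonvanishing (R : realType) (I : set R) (phi psi : R -> R) :
  regular_solution I phi psi ->
  (forall x, I x -> psi x = 0) \/ (forall x, I x -> psi x != 0).
Proof.
move=> sol.
have [|/existsNP[u /not_implyP[Iu /eqP u0]]] :=
  pselect (forall x, I x -> psi x = 0); first by left.
right=> z0 Iz0; apply/eqP => psiz0.
suff : psi u = 0 by exact/eqP.
have offz x : I x -> (phi x - phi u) * psi x = 0.
  move=> Ix; have [->|x0] := eqVneq (psi x) 0; first by rewrite mulr0.
  suff -> : phi x = phi u by rewrite subrr mul0r.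
  have [xu|ux|->//] := ltgtP x u.
  - exact: (phi_eq_off_zeros sol Iz0).
  - by apply/esym; exact: (phi_eq_off_zeros sol Iz0).
have [r r0 [Ia Ib]] := open_ball_in (sol_open sol) Iu.
have Iab x : u - r < x < u + r -> I x by move=> ?; apply: (sol_itv sol Ia Ib); lra.
apply: (@baire_one_reflect_eq0 _ (u - r) (u + r) psi [set x | phi x != phi u]).
- exact: (sol_psi_baire sol).
- move=> s t as_ st tb; apply: (sol_phi_nonconstant sol) => //;
    by apply: (sol_itv sol Ia Ib); lra.
- exact: (zeros_dense sol Iz0).
- move=> p q pab qab rab /= qu.
  have Ip := Iab _ pab; have Ir := Iab _ rab.
  have := sol_eq sol Ip Ir.
  have -> : (p + (2 * q - p)) / 2 = q by field.
  have := offz _ Ip; have := offz _ Ir; rewrite !mulrBl => /eqP + /eqP.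
  rewrite !subr_eq0 => /eqP -> /eqP -> /eqP.
  rewrite -mulrDr -subr_eq0 -mulrBl mulf_eq0 subr_eq0 (negPf qu)/= => /eqP.
  lra.
- lra.
Qed.

(** * Continuity *)

(** The contrapositive of the usual formulation: a value that is not attained
does not separate the values at the endpoints. *)
Definition intermediate_value_on (R : realType) (I : set R) (f : R -> R) : Prop :=
  forall a b c, I a -> I b -> a < b -> (forall x, a <= x <= b -> f x != c) ->
    0 < (f a - c) * (f b - c).

Lemma intermediate_value_opp (R : realType) (I : set R) (f : R -> R) :
  intermediate_value_on I f ->
  intermediate_value_on [set x | I (- x)] (fun x => f (- x)).
Proof.
move=> ivt a b c /= Ia Ib ab fc; rewrite mulrC; apply: ivt => //.
  by rewrite ltrN2.
by move=> x xab; rewrite -[x]opprK; apply: fc; lra.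
Qed.

(** Close to [f a] there is a value [f y] with y > a, since the values between
[f a] and [f b] are all attained.  Injectivity keeps [f x], for x between [a] and
[y], on the same side of [f a] as [f y] and on the same side of [f y] as [f a],
that is between the two. *)
Lemma intermediate_value_inj_right (R : realType) (I : set R) (f : R -> R)
    (a b e : R) :
  is_interval I -> intermediate_value_on I f ->
  (forall x y, I x -> I y -> x < y -> f x != f y) ->
  I a -> I b -> a < b -> 0 < e ->
  exists2 r, 0 < r & forall x, a <= x < a + r -> `|f a - f x| < e.
Proof.
move=> itvI ivt inj Ia Ib ab e0.
have Iab x : a <= x <= b -> I x by exact: (itvI _ _ Ia Ib).
have [y yab ye] : exists2 y, a < y <= b & `|f y - f a| < e.
  apply: contrapT => far.
  have faraway y : a < y <= b -> e <= `|f y - f a|.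
    by move=> yab; rewrite leNgt; apply/negP => ye; apply: far; exists y.
  (* Near f a but different from it, c would be attained only at points y > a
     where f y is far from f a; so it is not attained. *)
  have hit c : 0 < `|c - f a| < e -> 0 < (f a - c) * (f b - c).
    move=> /andP[c0 ce]; apply: ivt => // x xab; apply/eqP => xc.
    have [xa|xa] := eqVneq x a.
      by move: c0; rewrite -xc xa subrr normr0 ltxx.
    have : a < x by rewrite lt_neqAle eq_sym xa; lra.
    move=> ax; have := faraway x ltac:(lra).
    by rewrite xc leNgt ce.
  have := faraway b ltac:(lra); rewrite ler_normr => /orP[fb|fb].
  - have : 0 < `|(f a + e / 2) - f a| < e.
      by rewrite addrAC subrr add0r gtr0_norm; lra.
    move=> /hit; nra.
  - have : 0 < `|(f a - e / 2) - f a| < e.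
      by rewrite addrAC subrr add0r normrN gtr0_norm; lra.
    move=> /hit; nra.
exists (y - a); first by lra.
move=> x xay; rewrite distrC; have [->|xa] := eqVneq x a.
  by rewrite subrr normr0.
have ax : a < x by rewrite lt_neqAle eq_sym xa; lra.
have Ix : I x by apply: Iab; lra.
have Iy : I y by apply: Iab; lra.
have sa : 0 < (f x - f a) * (f y - f a).
  apply: ivt => //; first by lra.
  by move=> z zxy; rewrite eq_sym; apply: inj => //; [apply: Iab|]; lra.
have sy : 0 < (f a - f y) * (f x - f y).
  apply: ivt => // z zax; apply: inj => //; [apply: Iab|]; lra.
by move: ye; rewrite !ltr_norml; nra.
Qed.

(** Continuity from the left is continuity from the right of x |-> f (- x). *)
Lemma intermediate_value_inj_continuous (R : realType) (I : set R)
    (f : R -> R) :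
  open I -> is_interval I -> intermediate_value_on I f ->
  (forall x y, I x -> I y -> x < y -> f x != f y) ->
  forall x, I x -> {for x, continuous f}.
Proof.
move=> oI itvI ivt inj x Ix; apply/cvgrPdist_lt => e e0.
have [r r0 [Ia Ib]] := open_ball_in oI Ix.
have [|s s0 right] := intermediate_value_inj_right itvI ivt inj Ix Ib _ e0.
  by lra.
have [||||||t t0 left] := @intermediate_value_inj_right _ [set x | I (- x)]
    (fun x => f (- x)) (- x) (r - x) e _ (intermediate_value_opp ivt).
- move=> u v /= Iu Iv w uwv; apply: (itvI _ _ Iv Iu); lra.
- by move=> u v /= Iu Iv uv; rewrite eq_sym; apply: inj => //; lra.
- by rewrite /= opprK.
- by rewrite /= opprB.
- by lra.
- by [].
apply/nbhs_ballP; exists (Num.min s t) => /=; first by rewrite lt_min s0.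
move=> y; rewrite /ball/= lt_min => /andP[ys yt].
have [xy|yx] := leP x y.
- by apply: right; move: ys; rewrite ltr_norml; lra.
- have := left (- y); rewrite !opprK; apply.
  by move: yt; rewrite ltr_norml; lra.
Qed.

Lemma intermediate_value_derive1 (R : realType) (I : set R) (f : R -> R) :
  is_interval I -> (forall x, I x -> derivable f x 1) ->
  intermediate_value_on I (derive1 f).
Proof.
move=> itvI df a b c Ia Ib ab fc.
have Iab x : a <= x <= b -> I x by exact: (itvI _ _ Ia Ib).
pose g (x : R) := f x - c * x.
have did (x : R) : derivable (fun y : R => c * y) x 1.
  by apply: derivableM; [exact: derivable_cst|exact: derivable_id].
have dg x : I x -> derivable g x 1.
  by move=> Ix; apply: derivableB => //; exact: df.
have g' x : I x -> derive1 g x = derive1 f x - c.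
  move=> Ix; rewrite !derive1E deriveB//; last exact: df.
  congr (_ - _); rewrite deriveM; [|exact: derivable_cst|exact: derivable_id].
  by rewrite derive_id derive_cst scaler0 addr0 [LHS]mulr1.
rewrite -!g'//; apply: derive1_neq0_sign => // x /[dup]/Iab Ix xab.
- exact: dg.
- by rewrite g'// subr_eq0; exact: fc.
Qed.

(** Solving the equation for psi z, with y fixed and m = (z + y) / 2, gives
psi z = psi y * (phi m - phi y) / (phi z - phi m), where the denominator is
nonzero because [phi] is injective. *)
Lemma weight_continuous (R : realType) (I : set R) (phi psi : R -> R) :
  regular_solution I phi psi ->
  (forall x y, I x -> I y -> x < y -> phi x != phi y) ->
  (forall x, I x -> {for x, continuous phi}) ->
  forall x, I x -> {for x, continuous psi}.
Proof.
move=> sol inj cphi x Ix.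
have [r r0 [_ Iy]] := open_ball_in (sol_open sol) Ix.
set y := x + r in Iy.
have Im z : I z -> I ((z + y) / 2).
  move=> Iz; have [zy|yz] := leP z y.
  - by apply: (sol_itv sol Iz Iy); lra.
  - by apply: (sol_itv sol Iy Iz); lra.
have den z : I z -> z < y -> phi z - phi ((z + y) / 2) != 0.
  by move=> Iz zy; rewrite subr_eq0; apply: inj => //; [exact: Im|lra].
have psiE z : I z -> z < y -> psi z =
    psi y * (phi ((z + y) / 2) - phi y) / (phi z - phi ((z + y) / 2)).
  move=> Iz zy; have d0 := den z Iz zy.
  apply: (mulIf d0); rewrite mulfVK//.
  by have := sol_eq sol Iz Iy; lra.
have xy : x < y by rewrite /y; lra.
suff : psi z @[z --> x] --> psi x by [].
rewrite (psiE x Ix xy).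
apply: (@cvg_trans _ ((fun z =>
    psi y * (phi ((z + y) / 2) - phi y) / (phi z - phi ((z + y) / 2))) @ x)).
  apply: near_eq_cvg; near=> z; apply/esym/psiE.
    by near: z; exact: (open_nbhs_nbhs (conj (sol_open sol) Ix)).
  by near: z; exact: lt_nbhsl.
have cm : phi ((z + y) / 2) @[z --> x] --> phi ((x + y) / 2).
  apply: (@continuous_comp _ _ _ (fun z : R => (z + y) / 2) phi).
    apply: cvgM; last exact: cvg_cst.
    by apply: cvgD; [exact: cvg_id | exact: cvg_cst].
  exact: (cphi _ (Im x Ix)).
have cnum : psi y * (phi ((z + y) / 2) - phi y) @[z --> x] -->
    psi y * (phi ((x + y) / 2) - phi y).
  by apply: cvgM; [exact: cvg_cst|apply: cvgB => //; exact: cvg_cst].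
have cden : phi z - phi ((z + y) / 2) @[z --> x] -->
    phi x - phi ((x + y) / 2).
  by apply: cvgB => //; exact: cphi.
exact: cvgM cnum (cvgV (den x Ix xy) cden).
Unshelve. all: by end_near.
Qed.

(** The sign condition on [psi] is Darboux's theorem for g2 - g1, whose derivative
psi * (g1' * g2') has the sign of [psi]. *)
Lemma regular_solution_derivatives (R : realType) (I : set R)
    (phi psi F g1 g2 : R -> R) :
  open I -> is_interval I ->
  (forall x y, I x -> I y ->
    phi ((x + y) / 2) * (psi x + psi y) = phi x * psi x + phi y * psi y) ->
  differentiable_on I F -> differentiable_on I g1 -> differentiable_on I g2 ->
  (forall x, I x -> 0 < derive1 g1 x * derive1 g2 x) ->
  (forall x, I x -> phi x = 1 / 2 * derive1 F x) ->
  (forall x, I x -> psi x = 1 / derive1 g1 x - 1 / derive1 g2 x) ->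
  (forall a b c, I a -> I b -> a < b -> exists2 x, a < x < b & phi x != c) ->
  regular_solution I phi psi.
Proof.
move=> oI itvI feq dF dg1 dg2 g0 phiE psiE ncst.
have g10 x : I x -> derive1 g1 x != 0.
  by move=> /g0; apply: contraTneq => ->; rewrite mul0r ltxx.
have g20 x : I x -> derive1 g2 x != 0.
  by move=> /g0; apply: contraTneq => ->; rewrite mulr0 ltxx.
split=> //.
- move=> a b Ia Ib; have [r r0 [_ Ibr]] := open_ball_in oI Ib.
  have Iab x : a < x < b + r -> I x by move=> xab; apply: (itvI _ _ Ia Ibr); lra.
  apply: (@eq_baire_one _ _ _ (fun x => 1 / 2 * derive1 F x)).
    by move=> x xab; rewrite phiE//; apply: Iab; lra.
  apply: baire_oneM; first exact: baire_one_cst.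
  by apply: (baire_one_derive1 r0) => x /Iab; exact: dF.
- move=> a b Ia Ib; have [r r0 [_ Ibr]] := open_ball_in oI Ib.
  have Iab x : a < x < b + r -> I x by move=> xab; apply: (itvI _ _ Ia Ibr); lra.
  apply: (@eq_baire_one _ _ _ (fun x => (derive1 g1 x)^-1 - (derive1 g2 x)^-1)).
    by move=> x xab; rewrite psiE ?div1r//; apply: Iab; lra.
  apply: baire_oneB; apply: (baire_one_inv_derive1 r0) => x /Iab.
  + exact: dg1. + exact: g10. + exact: dg2. + exact: g20.
- move=> a b Ia Ib ab psi0.
  have Iab x : a <= x <= b -> I x by exact: (itvI _ _ Ia Ib).
  have dE x : I x -> derive1 (fun y => g2 y - g1 y) x =
      psi x * (derive1 g1 x * derive1 g2 x).
    move=> Ix; rewrite derive1E deriveB ?dg1 ?dg2//; [|exact: dg2|exact: dg1].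
    rewrite -!derive1E psiE//; have := g10 x Ix; have := g20 x Ix.
    by move=> ? ?; field; apply/andP.
  have : 0 < derive1 (fun y => g2 y - g1 y) a * derive1 (fun y => g2 y - g1 y) b.
    apply: derive1_neq0_sign => // x /[dup]/Iab Ix xab.
      by apply: derivableB; [exact: dg2|exact: dg1].
    by rewrite dE// !mulf_neq0 ?g10 ?g20 ?psi0.
  rewrite !dE// mulrACA pmulr_lgt0//.
  by rewrite mulr_gt0// g0.
Qed.

Theorem theorem4 (R : realType) (I : set R) (phi psi1 : R -> R)
  (hI : nonempty_open_interval I)
  (heq : forall x y, I x -> I y ->
    phi ((x + y) / 2) * (psi1 x + psi1 y) = phi x * psi1 x + phi y * psi1 y)
  (hreg : exists F g1 g2 : R -> R,
    [/\ [/\ differentiable_on I F, differentiable_on I g1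
          & differentiable_on I g2],
        forall x, I x -> 0 < derive1 g1 x * derive1 g2 x,
        forall x, I x -> phi x = 1 / 2 * derive1 F x
      & forall x, I x -> psi1 x = 1 / derive1 g1 x - 1 / derive1 g2 x])
  (hconst : ~ exists L : set R, [/\ nonempty_open_interval L, L `<=` I
      & exists c : R, forall x, L x -> phi x = c]) :
  (forall x, I x -> psi1 x = 0) \/
  [/\ ~ (psi1 @` I) 0, {within I, continuous phi}
    & {within I, continuous psi1}].
Proof.
have [[x0 Ix0] oI itvI] := hI.
have [F [g1 [g2 [[dF dg1 dg2] g0 phiE psiE]]]] := hreg.
have ncst a b c : I a -> I b -> a < b -> exists2 x, a < x < b & phi x != c.
  move=> Ia Ib ab; apply: contrapT => noy; apply: hconst.
  exists `]a, b[%classic; split.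
  - split; [|exact: itv_open|exact: interval_is_interval].
    by exists ((a + b) / 2); rewrite /= in_itv/=; lra.
  - by move=> x /=; rewrite in_itv/= => xab; apply: (itvI _ _ Ia Ib); lra.
  - exists c => x; rewrite /= in_itv/= => xab.
    by apply/eqP; apply: contraT => xc; exfalso; apply: noy; exists x.
have sol : regular_solution I phi psi1.
  exact: (@regular_solution_derivatives _ _ _ _ F g1 g2).
have [|psi0] := zero_or_nonvanishing sol; first by left.
have inj x y : I x -> I y -> x < y -> phi x != phi y.
  move=> Ix Iy xy; apply: (nonvanishing_inj sol) => // z zxy.
  by apply: psi0; apply: (itvI _ _ Ix Iy).
have cphi : forall x, I x -> {for x, continuous phi}.
  apply: intermediate_value_inj_continuous => // a b c Ia Ib ab phic.
  have phiE' x : a <= x <= b -> phi x = 1 / 2 * derive1 F x.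
    by move=> xab; apply: phiE; apply: (itvI _ _ Ia Ib).
  have : 0 < (derive1 F a - 2 * c) * (derive1 F b - 2 * c).
    apply: (intermediate_value_derive1 itvI dF) => // x xab.
    by have := phic x xab; rewrite phiE'//; apply: contraNneq => ->; apply/eqP; field.
  by rewrite !phiE'; [nra|lra..].
right; split.
- by move=> [x Ix x0']; have /eqP := psi0 x Ix.
- rewrite continuous_open_subspace// => x /set_mem; exact: cphi.
- rewrite continuous_open_subspace// => x /set_mem.
  exact: (weight_continuous sol inj cphi).
Qed.
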